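(* Fix a user $u$ and let $\pmb{h}_u=[h_{u,1},\ldots,h_{u,Q}]^{T}$ and $\tilde{\pmb{y}}_u=\sqrt{P_{c,r}}\,\pmb{h}_u+\dot{\pmb{n}}_u$ be as in the context. Then the LMMSE estimate $\hat{\pmb{h}}_u$ of $\pmb{h}_u$ from the observation $\tilde{\pmb{y}}_u$ has, for every $q\in\{1,\ldots,Q\}$, $q$-th element $$\hat{\pmb{h}}_u(q)=\frac{\sqrt{P_{c,r}}\,\sigma_{u,q}^2}{P_{c,r}\,\sigma_{u,q}^2+\tilde{\sigma}_{n,u}^2}\,\tilde{\pmb{y}}_u(q),\qquad \tilde{\sigma}_{n,u}^2=P_p\sigma_u^2+\sigma_n^2 .$$ Furthermore, with $\pmb{h}_u^{\mathrm{err}}=\pmb{h}_u-\hat{\pmb{h}}_u$, the channel estimation error covariance matrix is the diagonal matrix $$\pmb{\Sigma}_u=\mathbb{E}\big[\pmb{h}_u^{\mathrm{err}}(\pmb{h}_u^{\mathrm{err}})^{H}\big]=\operatorname{diag}\big((\sigma_{u,1}^{\mathrm{err}})^2,\ldots,(\sigma_{u,Q}^{\mathrm{err}})^2\big),\qquad (\sigma_{u,q}^{\mathrm{err}})^2=\frac{\tilde{\sigma}_{n,u}^2\,\sigma_{u,q}^2}{P_{c,r}\,\sigma_{u,q}^2+\tilde{\sigma}_{n,u}^2}.$$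
   Context: $Q\ge 1$ is the number of propagation paths of user $u$. The channel gain vector satisfies $\pmb{h}_u\sim\mathcal{CN}(\pmb{0}_Q,\operatorname{diag}(\sigma_{u,1}^2,\ldots,\sigma_{u,Q}^2))$ (circularly symmetric complex Gaussian) with $\sigma_{u,q}^2>0$, and $\sigma_u^2=\sum_{q=1}^{Q}\sigma_{u,q}^2$. $P_{c,r}>0$ is the pilot power (the pilot symbol is $\sqrt{P_{c,r}}$), $P_p\ge 0$ is the total private-message power, and $\sigma_n^2>0$ is the noise variance. The delay-Doppler support of the $Q$ channel taps is known and known phases are compensated, so the observation used for channel estimation is $\tilde{\pmb{y}}_u=\sqrt{P_{c,r}}\,\pmb{h}_u+\dot{\pmb{n}}_u\in\mathbb{C}^Q$, where the effective noise (private-message interference plus thermal noise) is modeled as $\dot{\pmb{n}}_u\sim\mathcal{CN}(\pmb{0}_Q,(P_p\sigma_u^2+\sigma_n^2)\pmb{I}_Q)$ and is uncorrelated with $\pmb{h}_u$. The LMMSE estimate is $\hat{\pmb{h}}_u=A\tilde{\pmb{y}}_u$, where $A\in\mathbb{C}^{Q\times Q}$ minimizes $\mathbb{E}\|\pmb{h}_u-A\tilde{\pmb{y}}_u\|^2$ over all $Q\times Q$ complex matrices; equivalently $\hat{\pmb{h}}_u=\mathbb{E}[\pmb{h}_u\tilde{\pmb{y}}_u^{H}]\,(\mathbb{E}[\tilde{\pmb{y}}_u\tilde{\pmb{y}}_u^{H}])^{-1}\tilde{\pmb{y}}_u$. *)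

(* Defs.v *)
From mathcomp Require Import all_boot all_order all_algebra.
From mathcomp Require Import all_classical all_reals all_analysis.
From mathcomp Require Import complex.

Set Implicit Arguments.
Unset Strict Implicit.
Unset Printing Implicit Defensive.

Import Order.TTheory GRing.Theory Num.Theory.
Import numFieldNormedType.Exports.

Local Open Scope classical_set_scope.
Local Open Scope ring_scope.
Local Open Scope complex_scope.
Local Open Scope sesquilinear_scope.

Section Definitions.
Context {d : measure_display} {T : measurableType d} {R : realType}.
Variable P : probability T R.

(* Variance 0 is a separate case: a point mass counts as Gaussian, whereas
   [normal_prob m 0] is by convention the uniform law on [0, 1]. *)
Definition gaussian_law (m s : R) (B : set R) : \bar R :=
  if s == 0 then \d_m B else normal_prob m s B.

Definition is_gaussian (X : T -> R) : Prop :=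
  measurable_fun setT X /\
  exists m s : R, forall B : set R, measurable B ->
    P (X @^-1` B) = gaussian_law m s B.

(* As [w] varies, Re (w^H X) runs over all real linear combinations of the real
   and imaginary parts of the coordinates of [X]; so this says that these 2n
   real random variables are jointly Gaussian. *)
Definition jointly_gaussian n (X : T -> 'cV[R[i]]_n) : Prop :=
  forall w : 'cV[R[i]]_n,
    is_gaussian (fun t => complex.Re ((w ^t* *m X t) 0 0)).

(* [fine] sends infinite values to 0; only meaningful for integrable [Z]. *)
Definition cexpectation (Z : T -> R[i]) : R[i] :=
  fine ('E_P[fun t => complex.Re (Z t)])
    +i* fine ('E_P[fun t => complex.Im (Z t)]).

Definition mxexpectation m n (M : T -> 'M[R[i]]_(m, n)) : 'M[R[i]]_(m, n) :=
  \matrix_(i, j) cexpectation (fun t => M t i j).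

Definition cross_covariance m n (X : T -> 'cV[R[i]]_m) (Y : T -> 'cV[R[i]]_n) :
    'M[R[i]]_(m, n) :=
  mxexpectation (fun t =>
    (X t - mxexpectation X) *m (Y t - mxexpectation Y) ^t*).

(* Transpose without conjugation: a complex Gaussian vector is circularly
   symmetric about its mean iff its pseudo-covariance vanishes. *)
Definition pseudo_covariance n (X : T -> 'cV[R[i]]_n) : 'M[R[i]]_n :=
  mxexpectation (fun t =>
    (X t - mxexpectation X) *m (X t - mxexpectation X)^T).

(* X ~ CN(mu, Gamma) *)
Definition circular_gaussian n (X : T -> 'cV[R[i]]_n)
    (mu : 'cV[R[i]]_n) (Gamma : 'M[R[i]]_n) : Prop :=
  [/\ jointly_gaussian X, mxexpectation X = mu,
      cross_covariance X X = Gamma & pseudo_covariance X = 0].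

Definition uncorrelated m n (X : T -> 'cV[R[i]]_m) (Y : T -> 'cV[R[i]]_n) :
    Prop :=
  cross_covariance X Y = 0.

Definition sqnorm n (v : 'cV[R[i]]_n) : R :=
  \sum_i (complex.Re (v i 0) ^+ 2 + complex.Im (v i 0) ^+ 2).

(* Valued in the extended reals: +oo when the error is not square-integrable. *)
Definition mean_square_error m n (X : T -> 'cV[R[i]]_m) (Y : T -> 'cV[R[i]]_n)
    (A : 'M[R[i]]_(m, n)) : \bar R :=
  'E_P[fun t => sqnorm (X t - A *m Y t)].

Definition lmmse_matrix m n (X : T -> 'cV[R[i]]_m) (Y : T -> 'cV[R[i]]_n)
    (A : 'M[R[i]]_(m, n)) : Prop :=
  forall B : 'M[R[i]]_(m, n),
    (mean_square_error X Y A <= mean_square_error X Y B)%E.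

Definition lmmse_estimate m n (X : T -> 'cV[R[i]]_m) (Y : T -> 'cV[R[i]]_n)
    (Xhat : T -> 'cV[R[i]]_m) : Prop :=
  exists2 A : 'M[R[i]]_(m, n), lmmse_matrix X Y A &
    forall t, Xhat t = A *m Y t.

End Definitions.

(* Main.v *)
(* Write M(X, Y) = E[X Y^H].  On square-integrable vectors M is sesquilinear,
   and if A solves the normal equation M(X, Y) = A M(Y, Y), the error X - A Y is
   orthogonal to Y, so that
     E|X - B Y|^2 = E|X - A Y|^2 + tr((A - B) M(Y, Y) (A - B)^H);
   when M(Y, Y) is positive definite, A is thus the unique minimiser, and its
   error covariance is M(X, X) - A M(Y, X).  Here M(h, y) and M(y, y) are real
   and diagonal, and the normal equation is solved entrywise.

   Gaussianity is used only through measurability: the covariances prescribe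
   nonzero second moments, which already forces square integrability. *)

Require Import Defs.
From mathcomp Require Import all_boot all_order all_algebra.
From mathcomp Require Import all_classical all_reals all_analysis.
From mathcomp Require Import complex.
From mathcomp Require Import measurable_realfun ring.

Import Order.TTheory GRing.Theory Num.Theory.
Import numFieldNormedType.Exports.

Local Open Scope classical_set_scope.
Local Open Scope ring_scope.
Local Open Scope complex_scope.
Local Open Scope sesquilinear_scope.

(** * Integrability and expectation of complex random variables, through real and imaginary parts *)

Section ComplexRandomVariables.
Context {d : measure_display} {T : measurableType d} {R : realType}.
Variable P : probability T R.

Definition cLfun (p : \bar R) (Z : T -> R[i]) : Prop :=
  (fun t => complex.Re (Z t)) \in Lfun P p /\
  (fun t => complex.Im (Z t)) \in Lfun P p.

Lemma ReM (z w : R[i]) : complex.Re (z * w) =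
  complex.Re z * complex.Re w - complex.Im z * complex.Im w.
Proof. by case: z w => [a b] [u v]. Qed.

Lemma ImM (z w : R[i]) : complex.Im (z * w) =
  complex.Re z * complex.Im w + complex.Im z * complex.Re w.
Proof. by case: z w => [a b] [u v]. Qed.

Lemma ReJ (z : R[i]) : complex.Re (z^*)%R = complex.Re z.
Proof. by case: z. Qed.

Lemma ImJ (z : R[i]) : complex.Im (z^*)%R = - complex.Im z.
Proof. by case: z. Qed.

Lemma Re_sum (I : Type) (s : seq I) (F : I -> R[i]) :
  complex.Re (\sum_(i <- s) F i) = \sum_(i <- s) complex.Re (F i).
Proof. exact: raddf_sum. Qed.

Lemma Re_mul_conj (z : R[i]) :
  complex.Re (z * (z^*)%R) = complex.Re z ^+ 2 + complex.Im z ^+ 2.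
Proof. by rewrite ReM ReJ ImJ; ring. Qed.

Lemma LfunD (p : \bar R) (f g : T -> R) : (1 <= p)%E ->
  f \in Lfun P p -> g \in Lfun P p -> (fun t => f t + g t) \in Lfun P p.
Proof. by move=> p1 fp gp; exact: (Lfun_addr_closed P p1).2. Qed.

Lemma LfunZ (p : \bar R) a (f : T -> R) : (1 <= p)%E ->
  f \in Lfun P p -> (fun t => a * f t) \in Lfun P p.
Proof.
move=> p1 fp; have [L0 /(_ a f 0 fp L0)] := Lfun_submod_closed P p1.
by rewrite addr0.
Qed.

Lemma LfunB (p : \bar R) (f g : T -> R) : (1 <= p)%E ->
  f \in Lfun P p -> g \in Lfun P p -> (fun t => f t - g t) \in Lfun P p.
Proof.
move=> p1 fp gp; apply: LfunD => //.
exact: Lfun_oppr_closed gp.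
Qed.

(** The entry point to square integrability: the norm of exponent 2 is the square root of this
    integral, so it is finite as soon as the integral is. *)
Lemma Lfun2P (f : T -> R) : measurable_fun setT f ->
  (\int[P]_t (f t ^+ 2)%:E < +oo)%E -> f \in Lfun P 2%:E.
Proof.
move=> mf If; rewrite inE; apply/andP; split; rewrite inE//=.
rewrite /finite_norm unlock poweR_lty//.
under eq_integral do rewrite /= powR_mulrn// real_normK ?num_real//.
exact: If.
Qed.

Lemma cLfunD p (Z W : T -> R[i]) : (1 <= p)%E ->
  cLfun p Z -> cLfun p W -> cLfun p (fun t => Z t + W t).
Proof.
move=> p1 [Zr Zi] [Wr Wi]; split.
- under [X in X \in _]eq_fun do rewrite raddfD; exact: LfunD.
- under [X in X \in _]eq_fun do rewrite raddfD; exact: LfunD.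
Qed.

Lemma cLfunZ p a (Z : T -> R[i]) : (1 <= p)%E ->
  cLfun p Z -> cLfun p (fun t => a * Z t).
Proof.
move=> p1 [Zr Zi]; split.
- under [X in X \in _]eq_fun do rewrite ReM.
  by apply: LfunB => //; exact: LfunZ.
- under [X in X \in _]eq_fun do rewrite ImM.
  by apply: LfunD => //; exact: LfunZ.
Qed.

Lemma cLfun0 p : (1 <= p)%E -> cLfun p (fun=> 0).
Proof. by move=> p1; have [L0 _] := Lfun_submod_closed P p1; split. Qed.

Lemma cLfun_sum p (I : Type) (s : seq I) (F : I -> T -> R[i]) : (1 <= p)%E ->
  (forall i, cLfun p (F i)) -> cLfun p (fun t => \sum_(i <- s) F i t).
Proof.
move=> p1 FL; elim: s => [|i s IH].
  under eq_fun do rewrite big_nil; exact: cLfun0.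
under eq_fun do rewrite big_cons; exact: cLfunD.
Qed.

(** Both parts of the product are sums or differences of products of two real square-integrable
    functions, each integrable by Hölder. This makes every entry of a second-moment matrix a genuine
    expectation. *)
Lemma cLfun2_mul_conj (Z W : T -> R[i]) : cLfun 2%:E Z -> cLfun 2%:E W ->
  cLfun 1%E (fun t => Z t * ((W t)^*)%R).
Proof.
move=> [Zr Zi] [Wr Wi]; split.
- under [X in X \in _]eq_fun do rewrite ReM ReJ ImJ mulrN opprK.
  by apply: LfunD => //; exact: Lfun2_mul_Lfun1.
- under [X in X \in _]eq_fun do rewrite ImM ReJ ImJ mulrN addrC.
  by apply: LfunB => //; exact: Lfun2_mul_Lfun1.
Qed.

(** [fine] respects addition on finite values; integrability guarantees that both expectations are
    finite. *)
Lemma fine_expectationD (f g : T -> R) : f \in Lfun P 1 -> g \in Lfun P 1 ->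
  fine 'E_P[fun t => f t + g t] = fine 'E_P[f] + fine 'E_P[g].
Proof.
by move=> f1 g1; rewrite expectationD// fineD// expectation_fin_num.
Qed.

Lemma fine_expectationZ a (f : T -> R) : f \in Lfun P 1 ->
  fine 'E_P[fun t => a * f t] = a * fine 'E_P[f].
Proof.
move=> f1; under eq_fun do rewrite mulrC.
by rewrite expectationZl// fineM// expectation_fin_num.
Qed.

Lemma fine_expectationB (f g : T -> R) : f \in Lfun P 1 -> g \in Lfun P 1 ->
  fine 'E_P[fun t => f t - g t] = fine 'E_P[f] - fine 'E_P[g].
Proof.
by move=> f1 g1; rewrite expectationB// fineB// expectation_fin_num.
Qed.

Lemma cexpectationD (Z W : T -> R[i]) : cLfun 1%E Z -> cLfun 1%E W ->
  cexpectation P (fun t => Z t + W t) = cexpectation P Z + cexpectation P W.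
Proof.
move=> [Zr Zi] [Wr Wi]; rewrite /cexpectation.
under eq_fun do rewrite raddfD.
under [in X in _ +i* fine X]eq_fun do rewrite raddfD.
by rewrite !fine_expectationD.
Qed.

Lemma cexpectationZ a (Z : T -> R[i]) : cLfun 1%E Z ->
  cexpectation P (fun t => a * Z t) = a * cexpectation P Z.
Proof.
move=> [Zr Zi]; rewrite /cexpectation.
under eq_fun do rewrite ReM.
under [in X in _ +i* fine X]eq_fun do rewrite ImM.
rewrite fine_expectationB ?fine_expectationD ?LfunZ// !fine_expectationZ//.
by case: a.
Qed.

Lemma cexpectation_conj (Z : T -> R[i]) : cLfun 1%E Z ->
  cexpectation P (fun t => (Z t)^*)%R = ((cexpectation P Z)^*)%R.
Proof.
move=> [Zr Zi]; rewrite /cexpectation.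
under eq_fun do rewrite ReJ.
under [in X in _ +i* fine X]eq_fun do rewrite ImJ -mulN1r.
by rewrite fine_expectationZ// mulN1r.
Qed.

Lemma cexpectation_sum (I : Type) (s : seq I) (F : I -> T -> R[i]) :
  (forall i, cLfun 1%E (F i)) ->
  cexpectation P (fun t => \sum_(i <- s) F i t) =
  \sum_(i <- s) cexpectation P (F i).
Proof.
move=> FL; elim: s => [|i s IH].
  under eq_fun do rewrite big_nil.
  by rewrite big_nil /cexpectation/= expectation_cst.
under eq_fun do rewrite big_cons.
by rewrite big_cons cexpectationD// ?IH//; exact: cLfun_sum.
Qed.

End ComplexRandomVariables.

(** * Second-moment matrices, the orthogonality principle and uniqueness of the LMMSE matrix *)

Section SecondMoments.
Context {d : measure_display} {T : measurableType d} {R : realType}.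
Variable P : probability T R.
Set Implicit Arguments.
Unset Strict Implicit.

Definition sqint n (X : T -> 'cV[R[i]]_n) : Prop :=
  forall k, cLfun P 2%:E (fun t => X t k 0).

(** Uncentred, hence sesquilinear without any correction for means; it agrees with
    [cross_covariance] when both means vanish. *)
Definition moment m n (X : T -> 'cV[R[i]]_m) (Y : T -> 'cV[R[i]]_n) :
    'M[R[i]]_(m, n) :=
  mxexpectation P (fun t => X t *m (Y t)^t*).

Lemma momentE m n (X : T -> 'cV[R[i]]_m) (Y : T -> 'cV[R[i]]_n) k l :
  moment X Y k l = cexpectation P (fun t => X t k 0 * ((Y t l 0)^*)%R).
Proof.
rewrite mxE; congr cexpectation; apply/funext => t.
by rewrite mxE big_ord1 !mxE.
Qed.

Lemma sqintD n (X Y : T -> 'cV[R[i]]_n) :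
  sqint X -> sqint Y -> sqint (fun t => X t + Y t).
Proof.
move=> X2 Y2 k; under eq_fun do rewrite mxE.
by apply: cLfunD => //; rewrite lee1n.
Qed.

Lemma sqint_mulmx m n (A : 'M[R[i]]_(m, n)) (X : T -> 'cV[R[i]]_n) :
  sqint X -> sqint (fun t => A *m X t).
Proof.
move=> X2 k; under eq_fun do rewrite mxE.
apply: cLfun_sum => [|j]; first by rewrite lee1n.
by apply: cLfunZ; rewrite ?lee1n.
Qed.

(** Conjugation commutes with expectation. This Hermitian symmetry transfers the linearity rules
    from the first argument to the second. *)
Lemma moment_conj m n (X : T -> 'cV[R[i]]_m) (Y : T -> 'cV[R[i]]_n) :
  sqint X -> sqint Y -> moment Y X = (moment X Y)^t*.
Proof.
move=> X2 Y2; apply/matrixP => k l; rewrite [RHS]mxE [_^T _ _]mxE !momentE.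
rewrite -cexpectation_conj; last exact: cLfun2_mul_conj.
by congr cexpectation; apply/funext => t; rewrite rmorphM/= conjCK mulrC.
Qed.

Lemma momentDl m n (X X' : T -> 'cV[R[i]]_m) (Y : T -> 'cV[R[i]]_n) :
  sqint X -> sqint X' -> sqint Y ->
  moment (fun t => X t + X' t) Y = moment X Y + moment X' Y.
Proof.
move=> X2 X'2 Y2; apply/matrixP => k l; rewrite [RHS]mxE !momentE.
under eq_fun do rewrite mxE mulrDl.
by rewrite cexpectationD//; exact: cLfun2_mul_conj.
Qed.

Lemma moment_mulmxl m n p (A : 'M[R[i]]_(p, m)) (X : T -> 'cV[R[i]]_m)
    (Y : T -> 'cV[R[i]]_n) :
  sqint X -> sqint Y -> moment (fun t => A *m X t) Y = A *m moment X Y.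
Proof.
move=> X2 Y2; apply/matrixP => k l; rewrite [RHS]mxE !momentE.
under eq_fun do rewrite mxE mulr_suml.
have XY j : cLfun P 1%E (fun t => X t j 0 * ((Y t l 0)^*)%R).
  exact: cLfun2_mul_conj.
rewrite cexpectation_sum => [|j].
  apply: eq_bigr => j _; rewrite momentE -cexpectationZ//.
  by under eq_fun do rewrite -mulrA.
by under eq_fun do rewrite -mulrA; exact: cLfunZ.
Qed.

Lemma momentDr m n (X : T -> 'cV[R[i]]_m) (Y Y' : T -> 'cV[R[i]]_n) :
  sqint X -> sqint Y -> sqint Y' ->
  moment X (fun t => Y t + Y' t) = moment X Y + moment X Y'.
Proof.
move=> X2 Y2 Y'2; rewrite moment_conj//; last exact: sqintD.
by rewrite momentDl// linearD/= map_mxD -!moment_conj.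
Qed.

Lemma moment_mulmxr m n p (A : 'M[R[i]]_(p, n)) (X : T -> 'cV[R[i]]_m)
    (Y : T -> 'cV[R[i]]_n) :
  sqint X -> sqint Y -> moment X (fun t => A *m Y t) = moment X Y *m A ^t*.
Proof.
move=> X2 Y2; rewrite moment_conj//; last exact: sqint_mulmx.
by rewrite moment_mulmxl// (moment_conj X2)// trmx_mul map_mxM/= trmxCK.
Qed.

(** The squared norm is the trace of X X^H, and trace and real part commute with expectation. *)
Lemma expectation_sqnorm n (X : T -> 'cV[R[i]]_n) : sqint X ->
  ('E_P[fun t => sqnorm (X t)] = (complex.Re (\tr (moment X X)))%:E)%E.
Proof.
move=> X2.
have XL k : cLfun P 1 (fun t => X t k 0 * ((X t k 0)^*)%R).
  exact: cLfun2_mul_conj.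
have trE : (fun t => sqnorm (X t)) =
    (fun t => complex.Re (\sum_k X t k 0 * ((X t k 0)^*)%R)).
  apply/funext => t; rewrite Re_sum; apply: eq_bigr => k _.
  by rewrite -Re_mul_conj.
have [sL _] : cLfun P 1 (fun t => \sum_k X t k 0 * ((X t k 0)^*)%R).
  exact: cLfun_sum.
(* The left side lives in the extended reals; [sL] makes it finite, so the identity may be checked
   on real values. *)
rewrite trE -[LHS]fineK; last exact: expectation_fin_num.
congr EFin; transitivity (complex.Re (cexpectation P
    (fun t => \sum_k X t k 0 * ((X t k 0)^*)%R))) => //.
rewrite cexpectation_sum//; congr complex.Re.
by apply: eq_bigr => k _; rewrite momentE.
Qed.

(** Pythagoras: X - B Y splits as e + (A - B) Y with e = X - A Y, and the cross moments vanish by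
    the normal equation. *)
Lemma mean_square_error_orthogonal m n (X : T -> 'cV[R[i]]_m)
    (Y : T -> 'cV[R[i]]_n) (A B : 'M[R[i]]_(m, n)) : sqint X -> sqint Y ->
  moment X Y = A *m moment Y Y ->
  mean_square_error P X Y B = (mean_square_error P X Y A +
    (complex.Re (\tr ((A - B) *m moment Y Y *m (A - B)^t*)))%:E)%E.
Proof.
move=> X2 Y2 XY.
pose e t := X t - A *m Y t.
have eE : e = (fun t => X t + (- A) *m Y t).
  by apply/funext => t; rewrite mulNmx.
have e2 : sqint e by rewrite eE; apply: sqintD => //; exact: sqint_mulmx.
have eY : moment e Y = 0.
  rewrite eE momentDl//; last exact: sqint_mulmx.
  by rewrite moment_mulmxl// XY mulNmx subrr.
have Ye : moment Y e = 0.
  by rewrite (moment_conj e2 Y2) eY trmx0 map_mx0.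
have D2 := sqint_mulmx (A - B) Y2.
have mseA : mean_square_error P X Y A = (complex.Re (\tr (moment e e)))%:E.
  exact: expectation_sqnorm.
have mseB : mean_square_error P X Y B =
    ('E_P[fun t => sqnorm (e t + (A - B) *m Y t)])%E.
  congr expectation; apply/funext => t; congr sqnorm.
  by rewrite /e mulmxBl addrA subrK.
rewrite mseA mseB expectation_sqnorm; last exact: sqintD.
rewrite -EFinD -raddfD -linearD/=; congr (complex.Re (\tr _))%:E.
rewrite (momentDl e2 D2); last exact: sqintD.
rewrite (momentDr e2 e2 D2) (momentDr D2 e2 D2) (moment_mulmxr _ e2 Y2).
rewrite (moment_mulmxl _ Y2 e2) (moment_mulmxl _ Y2 D2).
rewrite (moment_mulmxr _ Y2 Y2) eY Ye.
by rewrite mul0mx mulmx0 addr0 add0r mulmxA.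
Qed.

(** Stated with row vectors so that the rows of a matrix D can be inserted directly when bounding
    the trace of D S D^H. *)
Definition posdefmx n (S : 'M[R[i]]_n) : Prop :=
  forall v : 'rV[R[i]]_n, v != 0 -> 0 < complex.Re ((v *m S *m v ^t*) 0 0).

(** The quadratic form is the sum of s_k |v_k|^2; if it vanishes, so does every term, and then every
    v_k. *)
Lemma posdef_diag_mx n (s : 'I_n -> R) : (forall k, 0 < s k) ->
  posdefmx (diag_mx (\row_k (s k)%:C)).
Proof.
move=> s0 v v0.
have vE : complex.Re ((v *m diag_mx (\row_k (s k)%:C) *m v ^t*) 0 0) =
    \sum_k s k * (complex.Re (v 0 k) ^+ 2 + complex.Im (v 0 k) ^+ 2).
  rewrite mxE Re_sum; apply: eq_bigr => k _.
  rewrite mul_mx_diag !mxE -Re_mul_conj mulrAC mulrC.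
  by rewrite [in LHS]ReM/= mul0r subr0.
have ge0 k : 0 <= s k * (complex.Re (v 0 k) ^+ 2 + complex.Im (v 0 k) ^+ 2).
  by rewrite mulr_ge0 ?addr_ge0 ?sqr_ge0// ltW.
rewrite vE lt_def sumr_ge0// andbT; apply: contra v0.
rewrite psumr_eq0// => /allP v0; apply/eqP/rowP => k.
have := v0 k (mem_index_enum k).
rewrite /= mulf_eq0 gt_eqF//= paddr_eq0 ?sqr_ge0// !sqrf_eq0 => /andP[r0 i0].
by rewrite mxE; apply/eqP; rewrite eq_complex r0 i0.
Qed.

(** The trace adds up the quadratic form of [S] over the rows of [D], and a nonzero [D] has a
    nonzero row. *)
Lemma tr_mul_posdefmx m n (D : 'M[R[i]]_(m, n)) (S : 'M[R[i]]_n) :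
  posdefmx S -> D != 0 -> 0 < complex.Re (\tr (D *m S *m D ^t*)).
Proof.
move=> S0 D0.
have rowE k : (D *m S *m D ^t*) k k = (row k D *m S *m (row k D) ^t*) 0 0.
  by rewrite -row_mul !mxE; apply: eq_bigr => j _; rewrite !mxE.
have ge0 k : 0 <= complex.Re ((D *m S *m D ^t*) k k).
  rewrite rowE; have [->|/S0/ltW//] := eqVneq (row k D) 0.
  by rewrite !mul0mx mxE.
rewrite /mxtrace Re_sum lt_def sumr_ge0// andbT; apply: contra D0.
rewrite psumr_eq0// => /allP Dk; apply/eqP/row_matrixP => k; rewrite row0.
apply/eqP; apply: contraTT (Dk k (mem_index_enum k)) => /S0 Sk.
by rewrite /= rowE gt_eqF.
Qed.

Lemma lmmse_matrixP m n (X : T -> 'cV[R[i]]_m) (Y : T -> 'cV[R[i]]_n)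
    (A B : 'M[R[i]]_(m, n)) : sqint X -> sqint Y ->
  posdefmx (moment Y Y) -> moment X Y = A *m moment Y Y ->
  lmmse_matrix P X Y B <-> B = A.
Proof.
move=> X2 Y2 S0 XY; have mseE := mean_square_error_orthogonal _ X2 Y2 XY.
(* Finiteness allows this error to be cancelled from an inequality in the extended reals. *)
have mseA : mean_square_error P X Y A \is a fin_num.
  rewrite /mean_square_error expectation_sqnorm//.
  under eq_fun do rewrite -mulNmx.
  by apply: sqintD => //; exact: sqint_mulmx.
split=> [/(_ A)|-> C].
  (* Comparing the minimiser [B] with [A] leaves an excess trace that is at most 0, whereas it is
     positive if [B] differs from [A]. *)
  rewrite [in X in (X <= _)%E]mseE -[leRHS]adde0 leeD2lE// lee_fin.
  by have [//|AB] := eqVneq B A;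
    rewrite leNgt tr_mul_posdefmx// subr_eq0 eq_sym.
rewrite (mseE C); apply: leeDl; rewrite lee_fin.
have [->|AC] := eqVneq (A - C) 0.
  by rewrite !mul0mx mxtrace0.
by rewrite ltW// tr_mul_posdefmx.
Qed.

(** The error e is orthogonal to Y, so E[e e^H] reduces to E[e X^H]. *)
Lemma moment_error m n (X : T -> 'cV[R[i]]_m) (Y : T -> 'cV[R[i]]_n)
    (A : 'M[R[i]]_(m, n)) : sqint X -> sqint Y ->
  moment X Y = A *m moment Y Y ->
  moment (fun t => X t - A *m Y t) (fun t => X t - A *m Y t) =
  moment X X - A *m moment Y X.
Proof.
move=> X2 Y2 XY.
have -> : (fun t => X t - A *m Y t) = (fun t => X t + (- A) *m Y t).
  by apply/funext => t; rewrite mulNmx.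
have A2 := sqint_mulmx (- A) Y2.
have e2 : sqint (fun t => X t + (- A) *m Y t) by exact: sqintD.
rewrite (momentDr e2 X2 A2) (moment_mulmxr _ e2 Y2).
rewrite !(momentDl X2 A2)// !(moment_mulmxl _ Y2)// XY.
by rewrite !mulNmx subrr mul0mx addr0.
Qed.

End SecondMoments.

(** * Measurability and square integrability of circular Gaussian vectors *)

Section GaussianVectors.
Context {d : measure_display} {T : measurableType d} {R : realType}.
Variable P : probability T R.
Set Implicit Arguments.
Unset Strict Implicit.

(** The test vectors e_k and i e_k isolate the two parts of coordinate [k], because the real part of
    -i z is the imaginary part of z. *)
Lemma jointly_gaussian_measurable n (X : T -> 'cV[R[i]]_n) k :
  jointly_gaussian P X ->
  measurable_fun setT (fun t => complex.Re (X t k 0)) /\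
  measurable_fun setT (fun t => complex.Im (X t k 0)).
Proof.
move=> GX.
have wE (c : R[i]) t :
    (((c *: delta_mx k 0 : 'cV_n)^t* *m X t) 0 0) = (c^*)%R * X t k 0.
  rewrite mxE (bigD1 k)//= big1 => [|j jk]; last first.
    by rewrite !mxE (negbTE jk) mulr0 rmorph0 mul0r.
  by rewrite addr0 !mxE !eqxx mulr1.
split.
  have [+ _] := GX (1 *: delta_mx k 0).
  by under eq_fun do rewrite wE rmorph1 mul1r.
have [+ _] := GX ('i *: delta_mx k 0).
under eq_fun do rewrite wE ReM ReJ ImJ/= mul0r sub0r mulN1r opprK.
by [].
Qed.

(* [fine] sends [+oo] to [0], so a nonzero second moment is a finite one. *)
Lemma circular_gaussian_sqint n (X : T -> 'cV[R[i]]_n) (G : 'M[R[i]]_n) :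
  circular_gaussian P X 0 G -> (forall k, complex.Re (G k k) != 0) ->
  sqint P X /\ moment P X X = G.
Proof.
move=> [GX X0 XG _] G0.
have mXG : moment P X X = G.
  rewrite -XG /cross_covariance X0 /moment.
  by under [in RHS]eq_fun do rewrite !subr0.
split=> // k; have [mr mi] := jointly_gaussian_measurable k GX.
have := G0 k; rewrite -mXG momentE /cexpectation/=.
under eq_fun do rewrite Re_mul_conj.
rewrite unlock => nfin.
have fin : (\int[P]_t (complex.Re (X t k 0) ^+ 2
    + complex.Im (X t k 0) ^+ 2)%:E < +oo)%E.
  by rewrite ltey; apply: contra nfin => /eqP ->.
have mr2 := measurable_funX 2 mr; have mi2 := measurable_funX 2 mi.
have mE := measurable_funD mr2 mi2.
(* The square of each part is dominated by the squared modulus, whose integral is finite. *)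
split; apply: Lfun2P => //; apply: le_lt_trans fin;
  apply: ge0_le_integral => //; do ?exact/measurable_EFinP.
- by move=> t _; rewrite lee_fin sqr_ge0.
- by move=> t _; rewrite lee_fin lerDl sqr_ge0.
- by move=> t _; rewrite lee_fin sqr_ge0.
- by move=> t _; rewrite lee_fin lerDr sqr_ge0.
Qed.

End GaussianVectors.

(** * Algebra of real diagonal matrices *)

Section RealDiagonalMatrices.
Context {R : realType} {n : nat}.
Implicit Types f g : 'I_n -> R.

(** Indexing by real functions turns each matrix identity of the channel model into a real identity
    at each index. *)
Definition rdiag f : 'M[R[i]]_n := diag_mx (\row_k (f k)%:C).

Lemma rdiagD f g : rdiag f + rdiag g = rdiag (fun k => f k + g k).
Proof.
rewrite /rdiag -linearD/=; congr diag_mx; apply/rowP => k.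
by rewrite !mxE rmorphD.
Qed.

Lemma rdiagB f g : rdiag f - rdiag g = rdiag (fun k => f k - g k).
Proof.
rewrite /rdiag -linearB/=; congr diag_mx; apply/rowP => k.
by rewrite !mxE rmorphB.
Qed.

Lemma rdiagM f g : rdiag f *m rdiag g = rdiag (fun k => f k * g k).
Proof.
rewrite /rdiag mulmx_diag; congr diag_mx; apply/rowP => k.
by rewrite !mxE rmorphM.
Qed.

Lemma rdiagJ f : (rdiag f)^t* = rdiag f.
Proof.
rewrite /rdiag tr_diag_mx map_diag_mx; congr diag_mx; apply/rowP => k.
by rewrite !mxE; apply/eqP; rewrite eq_complex/= oppr0 !eqxx.
Qed.

Lemma rdiag_cst (a : R) : rdiag (fun=> a) = (a%:C)%:M.
Proof.
by rewrite -diag_const_mx; congr diag_mx; apply/rowP => k; rewrite !mxE.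
Qed.

Lemma mul_rdiag f (v : 'cV[R[i]]_n) k : (rdiag f *m v) k 0 = (f k)%:C * v k 0.
Proof. by rewrite mul_diag_mx !mxE. Qed.

End RealDiagonalMatrices.

(** * The LMMSE estimate and its error covariance in the pilot model *)

Theorem theorem1 (R : realType) (d : measure_display) (T : measurableType d)
    (P : probability T R) (Q : nat) (sigma : 'I_Q -> R)
    (P_cr P_p sigma_n : R) (h n y : T -> 'cV[R[i]]_Q) :
  let sigma_u2 : R := \sum_(q < Q) sigma q ^+ 2 in
  let sigma_nu2 : R := P_p * sigma_u2 + sigma_n ^+ 2 in
  (1 <= Q)%N ->
  (forall q, 0 < sigma q ^+ 2) ->
  0 < P_cr -> 0 <= P_p -> 0 < sigma_n ^+ 2 ->
  circular_gaussian P h 0 (diag_mx (\row_(q < Q) (sigma q ^+ 2)%:C)) ->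
  circular_gaussian P n 0 (sigma_nu2%:C)%:M ->
  uncorrelated P h n ->
  (forall t, y t = (Num.sqrt P_cr)%:C *: h t + n t) ->
  (exists hhat : T -> 'cV[R[i]]_Q, lmmse_estimate P h y hhat) /\
  (forall hhat : T -> 'cV[R[i]]_Q, lmmse_estimate P h y hhat ->
    (forall t q,
      hhat t q 0 =
        (Num.sqrt P_cr * sigma q ^+ 2 / (P_cr * sigma q ^+ 2 + sigma_nu2))%:C
          * y t q 0) /\
    mxexpectation P (fun t => (h t - hhat t) *m (h t - hhat t) ^t*) =
      diag_mx (\row_(q < Q)
        (sigma_nu2 * sigma q ^+ 2 / (P_cr * sigma q ^+ 2 + sigma_nu2))%:C)).
Proof.
move=> sigma_u2 nu _ s0 Pcr0 Pp0 sn0 hG nG hn yE.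
have nu0 : 0 < nu.
  by rewrite ltr_wpDl// mulr_ge0// sumr_ge0// => q _; exact: ltW.
set c := Num.sqrt P_cr in yE *.
have cc : c * c = P_cr by rewrite -expr2 sqr_sqrtr// ltW.
pose s q := sigma q ^+ 2.
pose den q := P_cr * s q + nu.
have den0 q : 0 < den q by rewrite addr_gt0// mulr_gt0 ?s0.
have [h2 hh] : sqint P h /\ moment P h h = rdiag s.
  by apply: circular_gaussian_sqint hG _ => k; rewrite !mxE eqxx gt_eqF ?s0.
have [n2 nn] : sqint P n /\ moment P n n = rdiag (fun=> nu).
  rewrite rdiag_cst.
  by apply: circular_gaussian_sqint nG _ => k; rewrite !mxE eqxx gt_eqF.
(* Both means are zero, so being uncorrelated is the vanishing of the uncentred moment. *)
have {}hn : moment P h n = 0.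
  case: hG nG => [_ h0 _ _] [_ n0 _ _]; rewrite -hn /cross_covariance h0 n0.
  by under [in RHS]eq_fun do rewrite !subr0.
have nh : moment P n h = 0.
  by rewrite (moment_conj h2 n2) hn trmx0 map_mx0.
(* The scalar gain becomes a diagonal matrix so that the moment rules for matrix products apply. *)
have {yE} -> : y = (fun t => rdiag (fun=> c) *m h t + n t).
  by apply/funext => t; rewrite yE rdiag_cst mul_scalar_mx.
set Y : T -> _ := fun t => _.
have ch2 : sqint P (fun t => rdiag (fun=> c) *m h t) by exact: sqint_mulmx.
have Y2 : sqint P Y by exact: sqintD.
have hY : moment P h Y = rdiag (fun q => s q * c).
  by rewrite momentDr// moment_mulmxr// hh hn addr0 rdiagJ rdiagM.
have nY : moment P n Y = rdiag (fun=> nu).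
  by rewrite momentDr// moment_mulmxr// nh nn mul0mx add0r.
have YY : moment P Y Y = rdiag den.
  rewrite momentDl// moment_mulmxl// hY nY rdiagM rdiagD; congr rdiag.
  by apply/funext => q; rewrite /den -cc; ring.
(* The entrywise solution of the normal equation: [s q * c] from E[h y^H] divided by [den q] from
   E[y y^H]. *)
pose A := rdiag (fun q => c * s q / den q).
have AYY : moment P h Y = A *m moment P Y Y.
  rewrite hY YY rdiagM; congr rdiag; apply/funext => q.
  by rewrite divfK ?gt_eqF// mulrC.
have S0 : posdefmx (moment P Y Y) by rewrite YY; exact: posdef_diag_mx.
have AP := lmmse_matrixP _ h2 Y2 S0 AYY.
split; first by exists (fun t => A *m Y t), A; first exact/AP.
(* Uniqueness of the minimiser forces the matrix behind any LMMSE estimate to be [A]. *)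
move=> hhat [_ /AP-> hhatE]; split=> [t q|].
  by rewrite hhatE mul_rdiag.
under eq_fun do rewrite hhatE.
rewrite -/(moment P _ _) moment_error// hh.
(* What remains at index q is s - (c s / den)(s c) = nu s / den, which holds because den = c^2 s +
   nu. *)
rewrite (moment_conj h2 Y2) hY rdiagJ rdiagM rdiagB; congr rdiag.
apply/funext => q; rewrite -/(s q) -/(den q).
have := lt0r_neq0 (den0 q); rewrite /den -cc => ?.
by field.
Qed.
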